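(* Let $\mathscr{A}$ be an additive category and let $\mathscr{E}$ be an exact structure on $\mathscr{A}$. Then the exact category $(\mathscr{A},\mathscr{E})$ is partially abelian exact if and only if $\mathscr{A}$ is an abelian category and $\mathscr{E}$ is the class of all kernel-cokernel pairs in $\mathscr{A}$.
   Context: A kernel-cokernel pair in an additive category $\mathscr{A}$ is a pair $(i,p)$ of composable morphisms such that $i$ is a kernel of $p$ and $p$ is a cokernel of $i$. Given a class $\mathscr{E}$ of such pairs, a morphism $i$ is an admissible monic if $(i,p)\in\mathscr{E}$ for some $p$, and a morphism $p$ is an admissible epic if $(i,p)\in\mathscr{E}$ for some $i$. The class $\mathscr{E}$ is an exact structure on $\mathscr{A}$, and $(\mathscr{A},\mathscr{E})$ is an exact category (in the sense of Quillen), if $\mathscr{E}$ is closed under isomorphisms, identities are admissible monics and admissible epics, admissible monics and admissible epics are each closed under composition, push-outs of admissible monics along arbitrary morphisms exist and are admissible monics, and pull-backs of admissible epics along arbitrary morphisms exist and are admissible epics. An exact category is partially abelian exact if every morphism which is the composition of an admissible monic followed by an admissible epic has a factorization as an admissible epic followed by an admissible monic: that is, $f=em$ with $m$ an admissible monic and $e$ an admissible epic implies $f=ip$ for some admissible epic $p$ and some admissible monic $i$. *)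

(* Defs.v *)
From mathcomp Require Import all_boot ssralg.

Set Implicit Arguments.
Unset Strict Implicit.
Unset Printing Implicit Defensive.

Import GRing.Theory.
Local Open Scope ring_scope.

Declare Scope cat_scope.
Delimit Scope cat_scope with cat.

(* [compm g f] is "f first, then g". *)
Record preadditiveCategory := PreadditiveCategory {
  obj :> Type;
  hom : obj -> obj -> zmodType;
  idm : forall X, hom X X;
  compm : forall X Y Z, hom Y Z -> hom X Y -> hom X Z;
  compmA : forall W X Y Z (h : hom Y Z) (g : hom X Y) (f : hom W X),
    compm h (compm g f) = compm (compm h g) f;
  comp1m : forall X Y (f : hom X Y), compm (idm Y) f = f;
  compm1 : forall X Y (f : hom X Y), compm f (idm X) = f;
  compmDl : forall X Y Z (g h : hom Y Z) (f : hom X Y),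
    compm (g + h) f = compm g f + compm h f;
  compmDr : forall X Y Z (h : hom Y Z) (f g : hom X Y),
    compm h (f + g) = compm h f + compm h g
}.

Arguments hom {p} X Y.
Arguments idm {p} X.
Arguments compm {p X Y Z} g f.

Notation "g ∘ f" := (compm g f)
  (at level 40, left associativity) : cat_scope.
Local Open Scope cat_scope.

Definition is_zero_object (C : preadditiveCategory) (Z : C) : Prop :=
  forall X : C,
    (exists! f : hom Z X, True) /\ (exists! f : hom X Z, True).

Definition is_biproduct (C : preadditiveCategory) (X Y S : C)
    (i1 : hom X S) (i2 : hom Y S) (p1 : hom S X) (p2 : hom S Y) : Prop :=
  [/\ p1 ∘ i1 = idm X, p2 ∘ i2 = idm Y, p2 ∘ i1 = 0, p1 ∘ i2 = 0
    & i1 ∘ p1 + i2 ∘ p2 = idm S].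

Record additiveCategory := AdditiveCategory {
  preadditive_of :> preadditiveCategory;
  has_zero_object : exists Z : preadditive_of, is_zero_object Z;
  has_biproducts : forall X Y : preadditive_of,
    exists (S : preadditive_of) (i1 : hom X S) (i2 : hom Y S)
           (p1 : hom S X) (p2 : hom S Y), is_biproduct i1 i2 p1 p2
}.

Section Morphisms.
Variable C : preadditiveCategory.

Definition is_monic (X Y : C) (f : hom X Y) : Prop :=
  forall (T : C) (u v : hom T X), f ∘ u = f ∘ v -> u = v.

Definition is_epic (X Y : C) (f : hom X Y) : Prop :=
  forall (T : C) (u v : hom Y T), u ∘ f = v ∘ f -> u = v.

Definition isomorphism (X Y : C) (f : hom X Y) : Prop :=
  exists g : hom Y X, g ∘ f = idm X /\ f ∘ g = idm Y.

Definition is_kernel (X Y Z : C) (i : hom X Y) (p : hom Y Z) : Prop :=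
  p ∘ i = 0 /\
  forall (T : C) (t : hom T Y), p ∘ t = 0 -> exists! u : hom T X, i ∘ u = t.

(* [is_cokernel p i] : [p] is a cokernel of [i]. *)
Definition is_cokernel (X Y Z : C) (p : hom Y Z) (i : hom X Y) : Prop :=
  p ∘ i = 0 /\
  forall (T : C) (t : hom Y T), t ∘ i = 0 -> exists! u : hom Z T, u ∘ p = t.

Definition kernel_cokernel_pair (X Y Z : C) (i : hom X Y) (p : hom Y Z) :
    Prop :=
  is_kernel i p /\ is_cokernel p i.

(*    X --i--> Y
      |        |
      f        f'
      v        v
      X' -i'-> Y'    *)
Definition is_pushout (X Y X' Y' : C) (i : hom X Y) (f : hom X X')
    (i' : hom X' Y') (f' : hom Y Y') : Prop :=
  f' ∘ i = i' ∘ f /\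
  forall (T : C) (s : hom Y T) (t : hom X' T), s ∘ i = t ∘ f ->
    exists! u : hom Y' T, u ∘ f' = s /\ u ∘ i' = t.

(*    Y' -p'-> Z'
      |        |
      f'       f
      v        v
      Y --p--> Z     *)
Definition is_pullback (Y Z Y' Z' : C) (p : hom Y Z) (f : hom Z' Z)
    (p' : hom Y' Z') (f' : hom Y' Y) : Prop :=
  p ∘ f' = f ∘ p' /\
  forall (T : C) (s : hom T Y) (t : hom T Z'), p ∘ s = f ∘ t ->
    exists! u : hom T Y', f' ∘ u = s /\ p' ∘ u = t.

Definition pair_class : Type :=
  forall X Y Z : C, hom X Y -> hom Y Z -> Prop.

Definition admissible_monic (E : pair_class) (X Y : C) (i : hom X Y) : Prop :=
  exists (Z : C) (p : hom Y Z), E X Y Z i p.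

Definition admissible_epic (E : pair_class) (Y Z : C) (p : hom Y Z) : Prop :=
  exists (X : C) (i : hom X Y), E X Y Z i p.

Definition iso_closed (E : pair_class) : Prop :=
  forall (X Y Z X' Y' Z' : C) (i : hom X Y) (p : hom Y Z)
         (i' : hom X' Y') (p' : hom Y' Z')
         (a : hom X X') (b : hom Y Y') (c : hom Z Z'),
    isomorphism a -> isomorphism b -> isomorphism c ->
    b ∘ i = i' ∘ a -> c ∘ p = p' ∘ b ->
    E X Y Z i p -> E X' Y' Z' i' p'.

End Morphisms.

Record exact_structure (A : additiveCategory) (E : pair_class A) : Prop :=
  ExactStructure {
  exact_kernel_cokernel : forall (X Y Z : A) (i : hom X Y) (p : hom Y Z),
    E X Y Z i p -> kernel_cokernel_pair i p;
  exact_iso_closed : iso_closed E;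
  exact_id_monic : forall X : A, admissible_monic E (idm X);
  exact_id_epic : forall X : A, admissible_epic E (idm X);
  exact_comp_monic : forall (X Y Z : A) (g : hom Y Z) (f : hom X Y),
    admissible_monic E g -> admissible_monic E f ->
    admissible_monic E (g ∘ f);
  exact_comp_epic : forall (X Y Z : A) (g : hom Y Z) (f : hom X Y),
    admissible_epic E g -> admissible_epic E f ->
    admissible_epic E (g ∘ f);
  exact_pushout_exists : forall (X Y X' : A) (i : hom X Y) (f : hom X X'),
    admissible_monic E i ->
    exists (Y' : A) (i' : hom X' Y') (f' : hom Y Y'), is_pushout i f i' f';
  exact_pushout_monic : forall (X Y X' Y' : A) (i : hom X Y) (f : hom X X')
      (i' : hom X' Y') (f' : hom Y Y'),
    admissible_monic E i -> is_pushout i f i' f' -> admissible_monic E i';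
  exact_pullback_exists : forall (Y Z Z' : A) (p : hom Y Z) (f : hom Z' Z),
    admissible_epic E p ->
    exists (Y' : A) (p' : hom Y' Z') (f' : hom Y' Y), is_pullback p f p' f';
  exact_pullback_epic : forall (Y Z Y' Z' : A) (p : hom Y Z) (f : hom Z' Z)
      (p' : hom Y' Z') (f' : hom Y' Y),
    admissible_epic E p -> is_pullback p f p' f' -> admissible_epic E p'
}.

Definition partially_abelian_exact (A : additiveCategory) (E : pair_class A) :
    Prop :=
  forall (X Y Z : A) (f : hom X Z) (m : hom X Y) (e : hom Y Z),
    admissible_monic E m -> admissible_epic E e -> f = e ∘ m ->
    exists (I : A) (p : hom X I) (i : hom I Z),
      [/\ admissible_epic E p, admissible_monic E i & f = i ∘ p].

Record abelian_category (A : additiveCategory) : Prop := AbelianCategory {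
  abelian_kernels : forall (Y Z : A) (f : hom Y Z),
    exists (X : A) (i : hom X Y), is_kernel i f;
  abelian_cokernels : forall (X Y : A) (f : hom X Y),
    exists (Z : A) (p : hom Y Z), is_cokernel p f;
  abelian_monic_normal : forall (X Y : A) (i : hom X Y),
    is_monic i -> exists (Z : A) (f : hom Y Z), is_kernel i f;
  abelian_epic_normal : forall (Y Z : A) (p : hom Y Z),
    is_epic p -> exists (X : A) (f : hom X Y), is_cokernel p f
}.

(* Main.v *)
Require Import Defs.
From mathcomp Require Import all_boot ssralg.

(** The equivalence rests on the fact that in an additive category every
    morphism [f : X -> Z] factors through the biproduct of [X] and [Z], as the
    graph [(1, f)] followed by the second projection.  The graph is a coordinate
    inclusion for a sheared biproduct decomposition ([biproduct_shear]), and
    coordinate inclusions are push-outs of zero morphisms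
    ([biproduct_pushout]), hence admissible in any exact structure; dually for
    projections.  So a partially abelian exact category factors every morphism
    as an admissible epic followed by an admissible monic
    ([admissible_factorization]).

    Such a factorization [f = i p] makes the category abelian: the kernel of
    the epic [p] is a kernel of [f], and the cokernel of [i] is a cokernel of
    [f].  If [f] is monic then so is [p], and a cokernel that is monic is
    invertible ([monic_cokernel_iso]); thus [f] is [i] up to isomorphism, which
    makes it a kernel.  Since a kernel-cokernel pair is determined up to
    isomorphism by its monic, and [E] is closed under isomorphisms, [E] contains
    all such pairs.

    Conversely, in an abelian category every morphism has an epic-monic
    factorization through the cokernel of its kernel
    ([abelian_factorization]), both of whose factors belong to kernel-cokernel
    pairs.

    The statements about cokernels, epics and projections are obtained from
    those about kernels, monics and inclusions in the opposite category. *)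

Set Implicit Arguments.
Unset Strict Implicit.
Unset Printing Implicit Defensive.

Import GRing.Theory.
Local Open Scope ring_scope.
Local Open Scope cat_scope.

(** * Preadditive categories *)

Section Preadditive.
Variable C : preadditiveCategory.

Lemma comp0m (X Y Z : C) (f : hom X Y) : (0 : hom Y Z) ∘ f = 0.
Proof. by apply: (addrI (0 ∘ f)); rewrite -compmDl !addr0. Qed.

Lemma compm0 (X Y Z : C) (f : hom Y Z) : f ∘ (0 : hom X Y) = 0.
Proof. by apply: (addrI (f ∘ 0)); rewrite -compmDr !addr0. Qed.

Lemma compNm (X Y Z : C) (g : hom Y Z) (f : hom X Y) : (- g) ∘ f = - (g ∘ f).
Proof. by apply: (addrI (g ∘ f)); rewrite -compmDl !subrr comp0m. Qed.

Lemma compmN (X Y Z : C) (g : hom Y Z) (f : hom X Y) : g ∘ (- f) = - (g ∘ f).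
Proof. by apply: (addrI (g ∘ f)); rewrite -compmDr !subrr compm0. Qed.

Definition opposite : preadditiveCategory :=
  @PreadditiveCategory C (fun X Y => @hom C Y X) (@idm C)
    (fun X Y Z g f => f ∘ g)
    (fun W X Y Z h g f => esym (compmA f g h))
    (fun X Y f => compm1 f) (fun X Y f => comp1m f)
    (fun X Y Z g h f => compmDr f g h) (fun X Y Z h f g => compmDl f g h).

Lemma isomorphism_id (X : C) : isomorphism (idm X).
Proof. by exists (idm X); rewrite comp1m. Qed.

Lemma monic_of_zero (X Y : C) (f : hom X Y) :
  (forall (T : C) (u : hom T X), f ∘ u = 0 -> u = 0) -> is_monic f.
Proof.
move=> f0 T u v fuv; apply: subr0_eq; apply: f0.
by rewrite compmDr compmN fuv subrr.
Qed.

Lemma kernel_monic (X Y Z : C) (i : hom X Y) (p : hom Y Z) :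
  is_kernel i p -> is_monic i.
Proof.
move=> [pi0 iP] T u v iuv.
have [|w [_ w_uniq]] := iP T (i ∘ v); first by rewrite compmA pi0 comp0m.
by rewrite -(w_uniq u iuv) (w_uniq v).
Qed.

Lemma is_kernelP (X Y Z : C) (i : hom X Y) (p : hom Y Z) :
  is_monic i -> p ∘ i = 0 ->
  (forall (T : C) (t : hom T Y), p ∘ t = 0 -> exists u, i ∘ u = t) ->
  is_kernel i p.
Proof.
move=> i_monic pi0 iP; split=> // T t /iP [u iu].
by exists u; split=> // v iv; apply: i_monic; rewrite iu iv.
Qed.

Lemma kernel_comp_monic (X Y Z W : C) (k : hom X Y) (p : hom Y Z)
    (i : hom Z W) :
  is_monic i -> is_kernel k p -> is_kernel k (i ∘ p).
Proof.
move=> i_monic [pk0 kP]; split=> [|T t]; first by rewrite -compmA pk0 compm0.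
by rewrite -compmA => ipt; apply: kP; apply: i_monic; rewrite ipt compm0.
Qed.

(** A monic [p] with [p k = 0] forces [k = 0], and then the identity factors
    through the cokernel [p] of [k]: [p] is a split monic and an epic. *)
Lemma monic_cokernel_iso (X Y Z : C) (k : hom X Y) (p : hom Y Z) :
  is_monic p -> is_cokernel p k -> isomorphism p.
Proof.
move=> p_monic [pk0 pP].
have k0 : k = 0 by apply: p_monic; rewrite pk0 compm0.
have [|r [rp _]] := pP Y (idm Y); first by rewrite comp1m.
have [|q [_ q_uniq]] := pP Z p; first by [].
exists r; split=> //.
by rewrite -(q_uniq (p ∘ r)) -?compmA ?rp ?compm1 // (q_uniq (idm Z)) ?comp1m.
Qed.

(** A zero morphism imposes no condition on a cocone, so the push-out of
    two of them is the coproduct. *)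
Lemma biproduct_pushout (K X Y S : C) (i1 : hom X S) (i2 : hom Y S)
    (p1 : hom S X) (p2 : hom S Y) :
  is_biproduct i1 i2 p1 p2 -> is_pushout (0 : hom K Y) (0 : hom K X) i1 i2.
Proof.
move=> [p1i1 p2i2 p2i1 p1i2 ip1]; split=> [|T s t _]; first by rewrite !compm0.
exists (s ∘ p2 + t ∘ p1); split=> [|u [<- <-]]; last first.
  by rewrite -!compmA -compmDr addrC ip1 compm1.
by rewrite !compmDl -!compmA p1i1 p2i2 p2i1 p1i2 !compm1 !compm0 add0r addr0.
Qed.

(** The automorphism [(x, y) |-> (x, y + f x)] of the biproduct carries the
    first inclusion to the graph of [f]. *)
Lemma biproduct_shear (X Y S : C) (i1 : hom X S) (i2 : hom Y S)
    (p1 : hom S X) (p2 : hom S Y) (f : hom X Y) :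
  is_biproduct i1 i2 p1 p2 ->
  is_biproduct (i1 + i2 ∘ f) i2 p1 (p2 - f ∘ p1).
Proof.
move=> [p1i1 p2i2 p2i1 p1i2 ip1]; split=> //.
- by rewrite compmDr p1i1 compmA p1i2 comp0m addr0.
- by rewrite compmDl compNm -compmA p1i2 compm0 subr0.
- rewrite compmDl !compmDr !compNm p2i1 add0r compmA p2i2 comp1m.
  by rewrite -!compmA p1i1 compm1 [p1 ∘ _]compmA p1i2 comp0m compm0 oppr0 addr0 subrr.
by rewrite compmDl compmDr compmN -!compmA addrACA subrr addr0.
Qed.

End Preadditive.

(** * Duals *)

Section Duals.
Variable C : preadditiveCategory.

Lemma cokernel_epic (X Y Z : C) (i : hom X Y) (p : hom Y Z) :
  is_cokernel p i -> is_epic p.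
Proof. exact: (@kernel_monic (opposite C)). Qed.

Lemma cokernel_comp_epic (W X Y Z : C) (p : hom W X) (i : hom X Y)
    (q : hom Y Z) :
  is_epic p -> is_cokernel q i -> is_cokernel q (i ∘ p).
Proof. exact: (@kernel_comp_monic (opposite C)). Qed.

Lemma epic_kernel_iso (X Y Z : C) (i : hom X Y) (q : hom Y Z) :
  is_epic i -> is_kernel i q -> isomorphism i.
Proof.
move=> i_epic iq.
by have [j [ji ij]] := @monic_cokernel_iso (opposite C) _ _ _ q i i_epic iq;
  exists j.
Qed.

Lemma biproduct_pullback (K X Y S : C) (i1 : hom X S) (i2 : hom Y S)
    (p1 : hom S X) (p2 : hom S Y) :
  is_biproduct i1 i2 p1 p2 -> is_pullback (0 : hom X K) (0 : hom Y K) p2 p1.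
Proof.
move=> [p1i1 p2i2 p2i1 p1i2 ip1].
apply: (@biproduct_pushout (opposite C) K Y X S p2 p1 i2 i1).
by split=> //; rewrite -ip1 addrC.
Qed.

Lemma cokernel_unique (X Y Z W : C) (i : hom X Y) (p : hom Y Z)
    (q : hom Y W) :
  is_cokernel p i -> is_cokernel q i ->
  exists2 c : hom W Z, isomorphism c & c ∘ q = p.
Proof.
move=> pi qi; have [pi0 pP] := pi; have [qi0 qP] := qi.
have [c [cq _]] := qP _ p pi0; have [d [dp _]] := pP _ q qi0.
exists c => //; exists d; split.
  by apply: (cokernel_epic qi); rewrite -compmA cq comp1m.
by apply: (cokernel_epic pi); rewrite -compmA dp comp1m.
Qed.

End Duals.

(** * Partially abelian exact categories are abelian *)

Section Exact.
Variables (A : additiveCategory) (E : pair_class A).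
Hypothesis HE : exact_structure E.

(** The kernel of an identity is a zero morphism, and it is an admissible
    monic; the inclusion is a push-out of it. *)
Lemma biproduct_inclusion_admissible (X Y S : A) (i1 : hom X S) (i2 : hom Y S)
    (p1 : hom S X) (p2 : hom S Y) :
  is_biproduct i1 i2 p1 p2 -> admissible_monic E i1.
Proof.
move=> bip; have [K [z Ez]] := exact_id_epic HE Y.
have z0 : z = 0.
  by have [[] ] := exact_kernel_cokernel HE Ez; rewrite comp1m.
apply: (exact_pushout_monic HE) (biproduct_pushout K bip).
by exists Y, (idm Y); rewrite -z0.
Qed.

Lemma biproduct_projection_admissible (X Y S : A) (i1 : hom X S) (i2 : hom Y S)
    (p1 : hom S X) (p2 : hom S Y) :
  is_biproduct i1 i2 p1 p2 -> admissible_epic E p2.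
Proof.
move=> bip; have [K [z Ez]] := exact_id_monic HE X.
have z0 : z = 0.
  by have [[] ] := exact_kernel_cokernel HE Ez; rewrite compm1.
apply: (exact_pullback_epic HE) (biproduct_pullback K bip).
by exists X, (idm X); rewrite -z0.
Qed.

Hypothesis HP : partially_abelian_exact E.

Lemma admissible_factorization (X Z : A) (f : hom X Z) :
  exists (I W V : A) (k : hom W X) (p : hom X I) (i : hom I Z) (q : hom Z V),
    [/\ E k p, E i q & f = i ∘ p].
Proof.
have [S [i1 [i2 [p1 [p2 bip]]]]] := has_biproducts X Z.
have graphE : f = p2 ∘ (i1 + i2 ∘ f).
  have [_ p2i2 p2i1 _ _] := bip.
  by rewrite compmDr p2i1 compmA p2i2 comp1m add0r.
have graph_monic := biproduct_inclusion_admissible (biproduct_shear f bip).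
have proj_epic := biproduct_projection_admissible bip.
have [I [p [i [[W [k kp]] [V [q iq]] fE]]]] := HP graph_monic proj_epic graphE.
by exists I, W, V, k, p, i, q.
Qed.

Lemma monic_admissible (X Y : A) (f : hom X Y) :
  is_monic f -> admissible_monic E f.
Proof.
have [I [W [V [k [p [i [q [kp iq ->]]]]]]]] := admissible_factorization f.
move=> ip_monic.
have p_iso : isomorphism p.
  apply: monic_cokernel_iso (exact_kernel_cokernel HE kp).2 => T u v puv.
  by apply: ip_monic; rewrite -!compmA puv.
exists V, q; have [r [rp pr]] := p_iso.
apply: (exact_iso_closed HE) iq;
  [by exists p; split; [exact: pr | exact: rp] | exact: isomorphism_id
   | exact: isomorphism_id | | by rewrite comp1m compm1].
by rewrite comp1m -compmA pr compm1.
Qed.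

Lemma epic_admissible (Y Z : A) (f : hom Y Z) :
  is_epic f -> admissible_epic E f.
Proof.
have [I [W [V [k [p [i [q [kp iq ->]]]]]]]] := admissible_factorization f.
move=> ip_epic.
have i_iso : isomorphism i.
  apply: epic_kernel_iso (exact_kernel_cokernel HE iq).1 => T u v uvi.
  by apply: ip_epic; rewrite !compmA uvi.
exists W, k.
apply: (exact_iso_closed HE) kp; [exact: isomorphism_id
  | exact: isomorphism_id | exact: i_iso | by rewrite comp1m compm1
  | by rewrite compm1].
Qed.

Lemma partially_abelian_exact_abelian : abelian_category A.
Proof.
split.
- move=> Y Z f.
  have [I [W [V [k [p [i [q [kp iq ->]]]]]]]] := admissible_factorization f.
  exists W, k; apply: kernel_comp_monic (exact_kernel_cokernel HE kp).1.
  exact: kernel_monic (exact_kernel_cokernel HE iq).1.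
- move=> X Y f.
  have [I [W [V [k [p [i [q [kp iq ->]]]]]]]] := admissible_factorization f.
  exists V, q; apply: cokernel_comp_epic (exact_kernel_cokernel HE iq).2.
  exact: cokernel_epic (exact_kernel_cokernel HE kp).2.
- move=> X Y i /monic_admissible [Z [p /(exact_kernel_cokernel HE) [ip _]]].
  by exists Z, p.
move=> Y Z p /epic_admissible [X [i /(exact_kernel_cokernel HE) [_ pi]]].
by exists X, i.
Qed.

Lemma kernel_cokernel_pair_exact (X Y Z : A) (i : hom X Y) (p : hom Y Z) :
  kernel_cokernel_pair i p -> E i p.
Proof.
move=> [ip pi]; have [W [q iq]] := monic_admissible (kernel_monic ip).
have [c c_iso cq] := cokernel_unique pi (exact_kernel_cokernel HE iq).2.
apply: (exact_iso_closed HE) iq;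
  [exact: isomorphism_id | exact: isomorphism_id | exact: c_iso | | ].
  by rewrite comp1m compm1.
by rewrite cq compm1.
Qed.

End Exact.

(** * Factorization in abelian categories *)

Section Abelian.
Variables (A : additiveCategory) (HA : abelian_category A).

Lemma abelian_monic_pair (X Y : A) (i : hom X Y) :
  is_monic i -> exists (Z : A) (c : hom Y Z), kernel_cokernel_pair i c.
Proof.
move=> i_monic; have [Z [g [gi0 iP]]] := abelian_monic_normal HA i_monic.
have [V [c ci]] := abelian_cokernels HA i; have [ci0 cP] := ci.
exists V, c; split=> //; apply: is_kernelP => // T t ct0.
have [g' [g'c _]] := cP _ g gi0.
have [|u [iu _]] := iP T t; first by rewrite -g'c -compmA ct0 compm0.
by exists u.
Qed.

(** With [k] a kernel of [f] and [p] a cokernel of [k], write [f = i p].  To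
    see that [i] is monic, let [i u = 0] and let [q] be a cokernel of [u], so
    that [i] factors through [q].  The epic [q p] is a cokernel of some [h],
    and [f h = 0], so [h] factors through [k] and [p h = 0]; hence [p] factors
    through [q p], which makes [q] a split monic, and [q u = 0] gives
    [u = 0]. *)
Lemma abelian_factorization (X Z : A) (f : hom X Z) :
  exists (W I : A) (k : hom W X) (p : hom X I) (i : hom I Z),
    [/\ kernel_cokernel_pair k p, is_monic i & f = i ∘ p].
Proof.
have [W [k kf]] := abelian_kernels HA f; have [fk0 kP] := kf.
have [I [p pk]] := abelian_cokernels HA k; have [pk0 pP] := pk.
have [i [ip _]] := pP _ f fk0.
exists W, I, k, p, i; split=> //.
  split=> //; split=> // T t pt0; apply: kP.
  by rewrite -ip -compmA pt0 compm0.
apply: monic_of_zero => T u iu0.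
have [Q [q qu]] := abelian_cokernels HA u; have [qu0 qP] := qu.
have [i' [i'q _]] := qP _ i iu0.
have qp_epic : is_epic (q ∘ p).
  move=> V a b; rewrite !compmA => /(cokernel_epic pk).
  exact: (cokernel_epic qu).
have [V [h [qph0 hP]]] := abelian_epic_normal HA qp_epic.
have fh0 : f ∘ h = 0 by rewrite -ip -i'q -[i' ∘ q ∘ p]compmA -compmA qph0 compm0.
have [h' [kh' _]] := kP _ h fh0.
have [|r [rqp _]] := hP _ p; first by rewrite -kh' compmA pk0 comp0m.
have rq : r ∘ q = idm I.
  by apply: (cokernel_epic pk); rewrite -compmA rqp comp1m.
by rewrite -(comp1m u) -rq -compmA qu0 compm0.
Qed.

End Abelian.

Theorem mainTheorem4 (A : additiveCategory) (E : pair_class A)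
    (HE : exact_structure E) :
  partially_abelian_exact E <->
  (abelian_category A /\
   forall (X Y Z : A) (i : hom X Y) (p : hom Y Z),
     E X Y Z i p <-> kernel_cokernel_pair i p).
Proof.
split=> [HP | [HA EP] X Y Z f m e _ _ _].
  split=> [|X Y Z i p]; first exact: partially_abelian_exact_abelian HE HP.
  split; first exact: (exact_kernel_cokernel HE).
  exact: kernel_cokernel_pair_exact HE HP X Y Z i p.
have [W [I [k [p [i [kp i_monic fE]]]]]] := abelian_factorization HA f.
have [V [c ic]] := abelian_monic_pair HA i_monic.
exists I, p, i; split=> //.
  by exists W, k; apply/EP.
by exists V, c; apply/EP.
Qed.
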